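(* For every positive integer $n$, $$\mathrm{ex}(n,\mathbf A\mathbf B\mathbf C\mathbf D)=\left\lfloor \tfrac18 n^2\right\rfloor .$$ Moreover, for $n\ge 3$, a triple system $\mathcal F$ on $n$ vertices containing none of $\mathbf A,\mathbf B,\mathbf C,\mathbf D$ satisfies $|\mathcal F|=\lfloor \frac18 n^2\rfloor$ if and only if $\mathcal F$ is (up to isomorphism) of the form $\mathcal F_{n,k}$ for an optimally chosen $k$.
   Context: A triple system on a finite vertex set $V$, $|V|=n$, is a family $\mathcal F$ of distinct $3$-element subsets (triples) of $V$; $|\mathcal F|$ is its number of triples. We write $124$ for $\{1,2,4\}$ etc. Four configurations of three triples are considered: $\mathbf A=\{124,135,236\}$ (on 6 vertices), $\mathbf B=\{125,134,234\}$ (on 5 vertices), $\mathbf C=\{124,134,234\}$ (on 4 vertices), $\mathbf D=\{123,134,235\}$ (on 5 vertices). A triple system contains a configuration if some of its triples form a system isomorphic to it (not necessarily induced). $\mathrm{ex}(n,X_1\dots X_k)$ denotes the maximum number of triples in a triple system on $n$ vertices that contains none of the configurations $X_1,\dots,X_k$. For $n\ge3$ and a positive integer $k$ with $2k<n$, $\mathcal F_{n,k}$ is the following triple system: partition the $n$-element vertex set into $k$ pairs $A_1,\dots,A_k$ and a set $B$ of size $n-2k$; $\mathcal F_{n,k}$ consists of all $k(n-2k)$ triples $A_i\cup\{b\}$ with $1\le i\le k$, $b\in B$. An optimally chosen $k$ means one that maximizes $k(n-2k)$ for the given $n$, i.e. a $k$ as close as possible to $n/4$ (unique unless $n\equiv2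 \pmod 4$, in which case both $k=\frac{n\pm2}{4}$ are allowed, subject to $k$ being a positive integer with $2k<n$). *)

(* Defs.v *)
From mathcomp Require Import all_boot.

Set Implicit Arguments.
Unset Strict Implicit.
Unset Printing Implicit Defensive.

Definition triple_system (V : finType) (F : {set {set V}}) : bool :=
  [forall e in F, #|e| == 3].

(* Isolated vertices play no role: f only has to be injective on the vertices
   that are covered by the triples of X. *)
Definition isomorphic (U V : finType) (X : {set {set U}}) (G : {set {set V}})
    : bool :=
  [exists f : {ffun U -> V},
    dinjectiveb f (cover X) && ([set f @: (e : {set U}) | e in X] == G)].

(* Configurations carry the labels 1, ..., 6; the element 0 of 'I_7 is unused. *)
Definition config := {set {set 'I_7}}.

Definition triple (a b c : nat) : {set 'I_7} := [set inord a; inord b; inord c].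

Definition configA : config := [set triple 1 2 4; triple 1 3 5; triple 2 3 6].
Definition configB : config := [set triple 1 2 5; triple 1 3 4; triple 2 3 4].
Definition configC : config := [set triple 1 2 4; triple 1 3 4; triple 2 3 4].
Definition configD : config := [set triple 1 2 3; triple 1 3 4; triple 2 3 5].

Definition contains (V : finType) (F : {set {set V}}) (X : config) : bool :=
  [exists G : {set {set V}}, (G \subset F) && isomorphic X G].

Definition contains_none (V : finType) (F : {set {set V}}) (Xs : seq config)
    : bool :=
  all (fun X => ~~ contains F X) Xs.

Definition ex (n : nat) (Xs : seq config) : nat :=
  \max_(F : {set {set 'I_n}} | triple_system F && contains_none F Xs) #|F|.

(* F is the system F_{n,k}, n = #|V|, for some partition of V into k pairs A i
   and a rest B, so this is invariant under isomorphism; #|B| = n - 2k is forced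
   by the partition. *)
Definition is_Fnk (V : finType) (k : nat) (F : {set {set V}}) : Prop :=
  exists (A : 'I_k -> {set V}) (B : {set V}),
    [/\ forall i, #|A i| = 2,
        forall i j, i != j -> [disjoint A i & A j],
        forall i, [disjoint A i & B],
        (\bigcup_(i < k) A i) :|: B = [set: V]
      & F = [set A i :|: [set b] | i in 'I_k, b in B]].

Definition optimal (n k : nat) : Prop :=
  [/\ 0 < k, 2 * k < n
    & forall j, 0 < j -> 2 * j < n -> j * (n - 2 * j) <= k * (n - 2 * k)].

(* Main.v *)
Require Import Defs.
From mathcomp Require Import all_boot.
From mathcomp Require Import zify.

Set Implicit Arguments.
Unset Strict Implicit.
Unset Printing Implicit Defensive.

(** The four configurations are exactly the ways in which three distinct
    triples can cover the three pairs of a 3-set {a, b, c}, so avoiding all of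
    them means having no Berge triangle ([contains_none_berge_free]).

    In a system F without Berge triangle, at most one pair of a triple e lies
    in another triple: two such pairs ab and ac, together with bc inside e
    itself, would give a Berge triangle.  Hence e has a vertex, its centre, both
    of whose pairs in e lie in no other triple ([centred_exists]).  Join the
    centre of every triple to its two other vertices, the leaves.  This graph
    has 2|F| edges, because the pairs are private, and no triangle: the edges of
    a triangle coming from different triples would be a Berge triangle, and a
    single triple contributes a path only ([triangle_free_edge]).  Mantel's
    theorem gives 2|F| <= n^2/4, that is |F| <= n^2/8.

    Suppose now that |F| reaches the bound.  Then the graph has at least
    n^2/4 - 1 edges.  Following Mantel's proof with its error terms shows that
    it is bipartite between a set X and its complement, with at most one edge
    missing ([near_extremal]).  So little freedom forbids a vertex that is the
    centre of one triple and a leaf of another ([not_centre_and_leaf]), and then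
    all centres lie on one side, say X.  The edges at a centre come in pairs,
    so all degrees in X are even; one missing edge would spoil this, whence the
    graph is complete bipartite ([complete_from_parity]).  Two centres
    must pair up the complement of X in the same way, again because of Berge
    triangles ([leaf_pair_determined]).  These pairs are the sets A_i, and X is
    the set B of F_{n,k}. *)

(** * Forbidden configurations and Berge triangles *)

Definition berge_free (V : finType) (F : {set {set V}}) : Prop :=
  forall e1 e2 e3 a b c,
    e1 \in F -> e2 \in F -> e3 \in F -> e1 != e2 -> e1 != e3 -> e2 != e3 ->
    a != b -> a != c -> b != c ->
    a \in e1 -> b \in e1 -> a \in e2 -> c \in e2 -> b \in e3 -> c \in e3 ->
    False.

(** All four configurations are of this shape, with the extra vertices
    (p, q, r) equal to (4, 5, 6) for A, (5, 4, 4) for B, (4, 4, 4) for C and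
    (3, 4, 5) for D. *)
Definition triangle_config (p q r : nat) : config :=
  [set triple 1 2 p; triple 1 3 q; triple 2 3 r].

Lemma mem_triple a b c (i : 'I_7) : a < 7 -> b < 7 -> c < 7 ->
  (i \in triple a b c) = [|| i == a :> nat, i == b :> nat | i == c :> nat].
Proof. by move=> ha hb hc; rewrite !inE -!val_eqE /= !inordK // -orbA. Qed.

Lemma imset_triple (V : finType) (f : 'I_7 -> V) a b c :
  f @: triple a b c = [set f (inord a); f (inord b); f (inord c)].
Proof. by rewrite !imsetU !imset_set1. Qed.

(** Listing the images of the labels 1, 2, ... as a duplicate-free sequence
    produces the embedding; the shift by one reflects that labels start at 1. *)
Lemma contains_labelled (V : finType) (F : {set {set V}}) (v : V) (s : seq V)
    (p q r : nat) (l := fun i => nth v s i.-1) :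
  uniq s -> 3 <= size s <= 6 ->
  0 < p <= size s -> 0 < q <= size s -> 0 < r <= size s ->
  [set l 1; l 2; l p] \in F -> [set l 1; l 3; l q] \in F ->
  [set l 2; l 3; l r] \in F -> contains F (triangle_config p q r).
Proof.
move=> us sz_s hp hq hr Fp Fq Fr.
pose f := [ffun i : 'I_7 => l i].
have fE a b c : a < 7 -> b < 7 -> c < 7 ->
    f @: triple a b c = [set l a; l b; l c].
  by move=> ha hb hc; rewrite imset_triple !ffunE !inordK.
apply/existsP; exists [set f @: (e : {set 'I_7}) | e in triangle_config p q r].
apply/andP; split.
  apply/subsetP => _ /imsetP[e Xe ->].
  by move: Xe; rewrite !inE -orbA => /or3P[]/eqP ->; rewrite fE //; lia.
apply/existsP; exists f; rewrite eqxx andbT; apply/dinjectiveP.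
have coverP i : i \in cover (triangle_config p q r) -> 0 < i <= size s.
  case/bigcupP => e; rewrite !inE -orbA => /or3P[]/eqP ->;
    rewrite mem_triple; lia.
move=> i j /coverP hi /coverP hj; rewrite !ffunE /l => /eqP.
have [hi1 hi2] := andP hi; have [hj1 hj2] := andP hj.
rewrite nth_uniq ?prednK // => /eqP ij; apply: val_inj.
by rewrite /= -(prednK hi1) -(prednK hj1) ij.
Qed.

(** The labels 1, 2, 3 span a Berge triangle inside the configuration, and
    injectivity on the covered labels carries it over to F.  The bounds on q
    and r ensure that label 2 is missing from the second triple and label 1 from
    the third, which tells the three triples apart. *)
Lemma berge_free_contains (V : finType) (F : {set {set V}}) p q r :
  p < 7 -> 3 < q < 7 -> 3 < r < 7 ->
  berge_free F -> ~~ contains F (triangle_config p q r).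
Proof.
move=> p7 /andP[q3 q7] /andP[r3 r7] BF; apply/existsP => -[G /andP[/subsetP GF]].
case/existsP => f /andP[/dinjectiveP f_inj /eqP defG].
set X := triangle_config p q r in f_inj defG.
have memX : [/\ triple 1 2 p \in X, triple 1 3 q \in X & triple 2 3 r \in X].
  by rewrite !inE !eqxx ?orbT.
have [X1 X2 X3] := memX.
have sX e i : e \in X -> i \in e -> i \in cover X.
  by move=> Xe ie; apply/bigcupP; exists e.
have Ff e : e \in X -> f @: e \in F.
  by move=> Xe; apply: GF; rewrite -defG; apply/imsetP; exists e.
have memf e i : e \in X -> i \in cover X -> (f i \in f @: e) = (i \in e).
  move=> Xe Xi; apply/imsetP/idP => [[j je /f_inj ->//]|ie]; last by exists i.
  exact: sX je.
have h1 : (inord 1 : 'I_7) = 1 :> nat by rewrite inordK.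
have h2 : (inord 2 : 'I_7) = 2 :> nat by rewrite inordK.
have h3 : (inord 3 : 'I_7) = 3 :> nat by rewrite inordK.
have t12 : inord 1 \in triple 1 2 p by rewrite mem_triple ?h1.
have t22 : inord 2 \in triple 1 2 p by rewrite mem_triple ?h2.
have t13 : inord 1 \in triple 1 3 q by rewrite mem_triple ?h1.
have t33 : inord 3 \in triple 1 3 q by rewrite mem_triple ?h3.
have t23 : inord 2 \in triple 2 3 r by rewrite mem_triple ?h2.
have t32 : inord 3 \in triple 2 3 r by rewrite mem_triple ?h3.
have nt2 : inord 2 \notin triple 1 3 q.
  by rewrite mem_triple ?h2 // (ltn_eqF (ltnW q3)).
have nt1 : inord 1 \notin triple 2 3 r.
  by rewrite mem_triple ?h1 // (ltn_eqF (ltnW (ltnW r3))).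
have c1 := sX _ _ X1 t12; have c2 := sX _ _ X1 t22; have c3 := sX _ _ X2 t33.
have fneq i j : i \in cover X -> j \in cover X -> i != j :> nat -> f i != f j.
  by move=> ci cj; apply: contraNneq => /f_inj ->.
have eneq e e' i : e \in X -> e' \in X -> i \in e -> i \notin e' ->
    f @: e != f @: e'.
  move=> Xe Xe' ie ie'; have ci := sX _ _ Xe ie.
  by apply: contraNneq ie' => ee'; rewrite -(memf _ _ Xe' ci) -ee' memf.
apply: (BF (f @: triple 1 2 p) (f @: triple 1 3 q) (f @: triple 2 3 r)
  (f (inord 1)) (f (inord 2)) (f (inord 3))); rewrite ?memf ?Ff //.
- exact: eneq X1 X2 t22 nt2.
- exact: eneq X1 X3 t12 nt1.
- exact: eneq X2 X3 t13 nt1.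
- by apply: fneq => //; rewrite h1 h2.
- by apply: fneq => //; rewrite h1 h3.
- by apply: fneq => //; rewrite h2 h3.
Qed.

Lemma card3_third (V : finType) (e : {set V}) a b :
  #|e| = 3 -> a != b -> a \in e -> b \in e ->
  exists x, [/\ e = [set a; b; x], x != a & x != b].
Proof.
move=> e3 ab ae be; have : #|e :\ a :\ b| == 1.
  move: (cardsD1 a e) (cardsD1 b (e :\ a)); rewrite !inE ae be eq_sym ab /= e3.
  lia.
case/cards1P => x ex; have : x \in e :\ a :\ b by rewrite ex set11.
rewrite !inE => /and3P[xb xa xe]; exists x; split=> //.
by rewrite -(setD1K ae) -(@setD1K _ b (e :\ a)) ?inE ?be 1?eq_sym ?ab // ex setUA.
Qed.

(** Conversely, write the triples of a Berge triangle as abx, acy, bcz.  If one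
    of them is abc, this is C or D, according to whether the other two extra
    vertices coincide; otherwise x, y, z lie outside {a, b, c}, and the number
    of coincidences among them decides between A, B and C. *)
Lemma contains_none_berge_free (V : finType) (F : {set {set V}}) :
  triple_system F ->
  contains_none F [:: configA; configB; configC; configD] <-> berge_free F.
Proof.
move=> /forallP F3; have card3 e : e \in F -> #|e| = 3.
  by move=> Fe; apply/eqP; have /implyP := F3 e; apply.
split; last first.
  move=> BF; apply/and5P; split=> //.
  - exact: (berge_free_contains (p := 4) (q := 5) (r := 6)).
  - exact: (berge_free_contains (p := 5) (q := 4) (r := 4)).
  - exact: (berge_free_contains (p := 4) (q := 4) (r := 4)).
  - exact: (berge_free_contains (p := 3) (q := 4) (r := 5)).
case/and5P => /negP nA /negP nB /negP nC /negP nD _.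
have eqF (e e' : {set V}) : e \in F -> e = e' -> e' \in F by move=> ? <-.
(* In C the vertex lying in all three triples carries the label 4. *)
have noC a b c d : uniq [:: a; b; c; d] -> [set a; b; d] \in F ->
    [set a; c; d] \in F -> [set b; c; d] \in F -> False.
  move=> us; move=> *; apply: nC.
  by apply: (contains_labelled (v := a) (s := [:: a; b; c; d])).
have noD a b c x y : uniq [:: a; b; c; x; y] -> [set a; b; c] \in F ->
    [set a; c; x] \in F -> [set b; c; y] \in F -> False.
  move=> us; move=> *; apply: nD.
  by apply: (contains_labelled (v := a) (s := [:: a; b; c; x; y])).
have noB a b c x y : uniq [:: a; b; c; x; y] -> [set a; b; y] \in F ->
    [set a; c; x] \in F -> [set b; c; x] \in F -> False.
  move=> us; move=> *; apply: nB.
  by apply: (contains_labelled (v := a) (s := [:: a; b; c; x; y])).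
have noA a b c x y z : uniq [:: a; b; c; x; y; z] -> [set a; b; x] \in F ->
    [set a; c; y] \in F -> [set b; c; z] \in F -> False.
  move=> us; move=> *; apply: nA.
  by apply: (contains_labelled (v := a) (s := [:: a; b; c; x; y; z])).
have noCD a b c x y : a != b -> a != c -> b != c -> [set a; b; c] \in F ->
    [set a; c; x] \in F -> [set b; c; y] \in F ->
    x != a -> x != b -> x != c -> y != a -> y != b -> y != c -> False.
  move=> ab ac bc Fab Fac Fbc xa xb xc ya yb yc.
  have [xy|xy] := eqVneq x y.
    apply: (noC a b x c) => //; last first.
    - by apply: eqF Fbc _; rewrite -xy setUAC.
    - by apply: eqF Fac _; rewrite setUAC.
    by rewrite /= !inE !negb_or ab ac bc xc !(eq_sym _ x) xa xb.
  apply: (noD a b c x y) => //.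
  by rewrite /= !inE !negb_or ab ac bc xy !(eq_sym _ x) !(eq_sym _ y)
    xa xb xc ya yb yc.
move=> e1 e2 e3 a b c F1 F2 F3' e12 e13 e23 ab ac bc a1 b1 a2 c2 b3 c3.
have [x [E1 xa xb]] := card3_third (card3 _ F1) ab a1 b1.
have [y [E2 ya yc]] := card3_third (card3 _ F2) ac a2 c2.
have [z [E3 zb zc]] := card3_third (card3 _ F3') bc b3 c3.
subst e1 e2 e3.
have [xc|xc] := eqVneq x c.
  subst x; apply: (noCD a b c y z) => //.
    by apply: contraNneq e12 => ->; rewrite setUAC.
  by apply: contraNneq e13 => ->; rewrite (setUC [set b; c]) setUA.
have [yb|yb] := eqVneq y b.
  subst y; apply: (noCD a c b x z) => //.
  - by rewrite eq_sym.
  - by apply: eqF F3' _; rewrite (setUC [set c]).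
  by apply: contraNneq e23 => ->; rewrite (setUC [set b; c]) setUA setUAC.
have [za|za] := eqVneq z a.
  subst z; apply: (noCD b c a x y) => //; rewrite 1?eq_sym //.
  - by apply: eqF F1 _; rewrite (setUC [set b]).
  - by apply: eqF F2 _; rewrite (setUC [set c]).
have [ax bx cx] : [/\ a != x, b != x & c != x] by rewrite !(eq_sym _ x).
have [ay by_ cy] : [/\ a != y, b != y & c != y] by rewrite !(eq_sym _ y).
have [az bz cz] : [/\ a != z, b != z & c != z] by rewrite !(eq_sym _ z).
have [ba ca cb] : [/\ b != a, c != a & c != b].
  by rewrite !(eq_sym _ a) (eq_sym c).
have [xy|xy] := eqVneq x y; have [xz|xz] := eqVneq x z.
- subst y z; apply: (noC a b c x) => //.
  by rewrite /= !inE !negb_or ab ac bc ax bx cx.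
- subst y; apply: (noB b c a x z) => //.
  + by rewrite /= !inE !negb_or bc ba bx bz ca cx cz ax az xz.
  + by apply: eqF F1 _; rewrite (setUC [set a]).
  + by apply: eqF F2 _; rewrite (setUC [set a]).
- subst z; apply: (noB a c b x y) => //.
  + by rewrite /= !inE !negb_or ac ab ax ay cb cx cy bx by_ xy.
  + by apply: eqF F3' _; rewrite (setUC [set b]).
have [yz|yz] := eqVneq y z.
  subst z; apply: (noB a b c y x) => //.
  by rewrite /= !inE !negb_or ab ac ay ax bc by_ bx cy cx eq_sym xy.
apply: (noA a b c x y z) => //.
by rewrite /= !inE !negb_or ab ac ax ay az bc bx by_ bz cx cy cz xy xz yz.
Qed.

(** * Triangle-free graphs with almost the Mantel number of edges *)

Definition nbr (V : finType) (adj : rel V) (x : V) : {set V} := [set y | adj x y].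

Definition missing (V : finType) (adj : rel V) (X : {set V}) : nat :=
  \sum_(x in X) #|~: X :\: nbr adj x|.

Definition inner (V : finType) (adj : rel V) (X : {set V}) : nat :=
  \sum_(x in X) #|nbr adj x :&: X|.

Definition triangle_free (V : finType) (adj : rel V) : Prop :=
  forall a b c, adj a b -> adj a c -> adj b c -> False.

(** Mantel's theorem with its error terms.  Take X to be the set of
    non-neighbours of a vertex of maximal degree, so that its complement Y is
    independent.  A vertex of X has degree at most |Y|, hence at least as many
    non-neighbours in Y as neighbours in X. *)
Lemma mantel_deficit (V : finType) (adj : rel V) (v : V) :
  symmetric adj -> triangle_free adj ->
  exists X : {set V},
    [/\ forall x y, adj x y -> (x \in X) || (y \in X),
        inner adj X <= missing adj X
      & \sum_x #|nbr adj x| + 2 * missing adj X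
          = 2 * (#|X| * #|~: X|) + inner adj X].
Proof.
move=> adjC noT.
have [x0 _ max0] := @arg_maxnP _ v xpredT (fun x => #|nbr adj x|) isT.
exists (~: nbr adj x0); rewrite /missing /inner setCK; set Y := nbr adj x0.
have indY x y : adj x y -> (x \in ~: Y) || (y \in ~: Y).
  rewrite !inE -negb_and => xy; apply/negP => /andP[x0x x0y].
  exact: noT x0x x0y xy.
split=> //.
  apply: leq_sum => x _.
  rewrite -(leq_add2r #|Y :&: nbr adj x|) addnC (addnC #|Y :\: _|) cardsID.
  by rewrite setIC -setDE cardsID; apply: max0.
pose cross := \sum_(x in ~: Y) #|Y :&: nbr adj x|.
have crossE : cross + \sum_(x in ~: Y) #|Y :\: nbr adj x| = #|~: Y| * #|Y|.
  rewrite -big_split /= -sum_nat_const; apply: eq_bigr => x _.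
  by rewrite cardsID.
have innerE : \sum_(x in ~: Y) #|nbr adj x|
    = cross + \sum_(x in ~: Y) #|nbr adj x :&: ~: Y|.
  rewrite -big_split /=; apply: eq_bigr => x _.
  by rewrite setIC -setDE cardsID.
have crossC : \sum_(y in Y) #|nbr adj y| = cross.
  transitivity (\sum_(y in Y) \sum_(x in ~: Y) (adj x y : nat)).
    apply: eq_bigr => y Yy; rewrite -sum1_card big_mkcond [RHS]big_mkcond /=.
    apply: eq_bigr => x _; rewrite inE adjC.
    case xy: (adj x y); last by case: ifP.
    by have := indY _ _ xy; rewrite (inE, Yy) [y \in ~: Y]inE Yy orbF => ->.
  rewrite exchange_big; apply: eq_bigr => x _.
  rewrite -sum1_card big_mkcond [RHS]big_mkcond /=.
  by apply: eq_bigr => y _; rewrite !inE; case: (adj x0 y); case: (adj x y).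
have -> : \sum_x #|nbr adj x|
    = \sum_(x in ~: Y) #|nbr adj x| + \sum_(y in Y) #|nbr adj y|.
  rewrite (bigID (mem Y)) /= addnC; congr (_ + _).
  by apply: eq_bigl => x; rewrite in_setC.
by rewrite innerE crossC; lia.
Qed.

Lemma missing_le1 (V : finType) (adj : rel V) (X : {set V}) x y x' y' :
  missing adj X <= 1 ->
  x \in X -> y \notin X -> x' \in X -> y' \notin X ->
  ~~ adj x y -> ~~ adj x' y' -> x = x' /\ y = y'.
Proof.
rewrite /missing => M1 Xx Xy Xx' Xy' nxy nxy'.
have yx : y \in ~: X :\: nbr adj x by rewrite !inE nxy.
have yx' : y' \in ~: X :\: nbr adj x' by rewrite !inE nxy'.
have px : 0 < #|~: X :\: nbr adj x| by apply/card_gt0P; exists y.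
have px' : 0 < #|~: X :\: nbr adj x'| by apply/card_gt0P; exists y'.
move: M1; rewrite (bigD1 x) //=.
have [Exx|xx'] := eqVneq x x'.
  subst x'; move=> M1; split=> //.
  have /card_le1_eqP : #|~: X :\: nbr adj x| <= 1.
    by apply: leq_trans M1; rewrite leq_addr.
  by apply.
by rewrite (bigD1 x') /= ?Xx' 1?eq_sym //; lia.
Qed.

(** Since (x + y)^2 = 4xy + (x - y)^2, the squared difference of the sizes of the
    two sides and twice the slack m share the budget of 7 that rounding n^2/8
    down leaves. *)
Lemma near_balanced x y f m :
  (x + y) ^ 2 <= 8 * f + 7 -> 4 * f + m <= 2 * (x * y) ->
  exists d, [/\ d <= 2, d * d + 2 * m <= 7 & x = y + d \/ y = x + d].
Proof.
rewrite -mulnn; wlog le_yx : x y / y <= x.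
  move=> wl Hs Hm; case: (leqP y x) => [/wl|/ltnW/wl]; first exact.
  rewrite addnC (mulnC y) => /(_ Hs Hm)[d [d2 H E]].
  by exists d; split=> //; tauto.
rewrite -(subnKC le_yx); move: (x - y) => d Hs Hm.
have H : d * d + 2 * m <= 7 by rewrite !mulnDl !mulnDr in Hs Hm; lia.
exists d; split; [|exact: H|by left].
by case: d H {Hs Hm} => [|[|[|d]]] //; lia.
Qed.

(** To be applied to the sizes x and y of a set X and its complement, the number
    f of triples and the number m of missing edges; an edge inside X forces
    y <= m. *)
Lemma no_inner_edge_arith x y f m :
  2 < x + y -> (x + y) ^ 2 <= 8 * f + 7 -> 4 * f + m <= 2 * (x * y) ->
  0 < m -> y <= m -> False.
Proof.
move=> n3 Hs Hm m0 ym; have [d [d2 H E]] := near_balanced Hs Hm.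
have y3 : y <= 3 by clear -H ym; lia.
rewrite -mulnn in Hs.
(* Only the values y <= 3 and |x - y| <= 2 are left. *)
case: d d2 H E => [|[|[|//]]] _ H E;
  case: y y3 n3 Hs Hm ym E => [|[|[|[|//]]]] _ n3 Hs Hm ym [] E;
  (try subst x); (try lia); (have : x <= 3 by clear -E; lia);
  by case: x n3 Hs Hm E => [|[|[|[|//]]]] n3 Hs Hm E _; lia.
Qed.

Lemma missing_arith x y f m :
  2 < x + y -> (x + y) ^ 2 <= 8 * f + 7 -> 2 * f + m = x * y ->
  m <= 1 /\ (m = 1 -> 1 < x /\ 1 < y).
Proof.
move=> n3 Hs Hm.
have [|d [d2 H E]] := @near_balanced x y f (2 * m) Hs; first by rewrite -Hm; lia.
have m1 : m <= 1 by clear -H; lia.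
split=> // M1; subst m.
have d1 : d <= 1 by case: d d2 H {E} => [|[|[|]]].
move: {H Hs} d1 => d1.
case: d d1 {d2} E => [|[|//]] _; rewrite ?addn0 ?addn1 => E.
  have {}E : x = y by case: E.
  by subst y; case: x n3 Hm => [|[|]].
case: E => E; [subst x; move: y n3 Hm|subst y; move: x n3 Hm] => z;
  by case: z => [|[|z]] //; lia.
Qed.

(** The degree sum 4f stands for 2f edges, the number of private pairs of f
    triples.  When f = n^2/8, rounded down, and n = 2 (mod 4), this is one less
    than the Mantel number, so that one edge can indeed be missing.  The last
    clause provides a second vertex on either side for comparing the parities
    of two degrees. *)
Lemma near_extremal (V : finType) (adj : rel V) (f : nat) :
  3 <= #|V| -> symmetric adj -> triangle_free adj ->
  \sum_x #|nbr adj x| = 4 * f -> #|V| ^ 2 %/ 8 <= f ->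
  exists X : {set V},
    [/\ forall x y, adj x y -> (x \in X) != (y \in X),
        missing adj X <= 1
      & missing adj X = 1 -> 1 < #|X| /\ 1 < #|~: X|].
Proof.
move=> n3 adjC noT sumE leF.
have /card_gt0P[v _] : 0 < #|V| by lia.
have [X [indY leI E]] := mantel_deficit v adjC noT.
have szV := cardsC X.
have leF8 : #|V| ^ 2 <= 8 * f + 7.
  by have := divn_eq (#|V| ^ 2) 8; have := ltn_pmod (#|V| ^ 2) (d := 8) isT; lia.
rewrite sumE in E; rewrite -szV in leF8 n3.
have I0 : inner adj X = 0.
  apply/eqP; rewrite -leqn0 leqNgt; apply/negP => Ipos.
  (* By triangle-freeness, each vertex outside X is not adjacent to one of the
     ends of an edge inside X. *)
  have leM : #|~: X| <= missing adj X.
    have [x Xx [x' [Xx' xx']]] :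
        exists2 x, x \in X & exists x', x' \in X /\ adj x x'.
      have /existsP[x /andP[Xx]] : [exists x in X, 0 < #|nbr adj x :&: X|].
        apply: contraLR Ipos => /existsPn H; rewrite -leqNgt leqn0.
        rewrite /inner big1 // => x Xx; apply/eqP; rewrite -leqn0 leqNgt.
        by have := H x; rewrite Xx.
      case/card_gt0P => x'; rewrite !inE => /andP[? ?].
      by exists x => //; exists x'.
    have nxx' : x' != x.
      by apply/eqP => E'; rewrite E' in xx'; exact: (noT _ _ _ xx' xx' xx').
    rewrite /missing (bigD1 x) //= (bigD1 x') /= ?Xx' ?nxx' //.
    rewrite addnA; apply: leq_trans (leq_addr _ _).
    apply: leq_trans (leq_card_setU _ _).1; apply: subset_leq_card.
    apply/subsetP => y; rewrite !inE => Xy; rewrite Xy !andbT -negb_and.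
    by apply/negP => /andP[xy x'y]; apply: noT xx' xy x'y.
  apply: (no_inner_edge_arith n3 leF8 _ _ leM).
    by rewrite -(leq_add2r (missing adj X)) -addnA addnn -mul2n E leq_add2l.
  exact: leq_trans leI.
have [|M1 M1'] := missing_arith (m := missing adj X) n3 leF8.
  by move: E; rewrite I0; lia.
exists X; split=> //.

move=> x y xy; have := indY x y xy.
case Xx: (x \in X); case Xy: (y \in X) => // _.
move: I0; rewrite /inner (bigD1 x) //= => /eqP; rewrite addn_eq0 cards_eq0.
by case/andP => /eqP/setP/(_ y); rewrite !inE xy Xy.
Qed.

(** * Centres and private pairs *)

Definition centred (V : finType) (F : {set {set V}}) (ctr : {set V} -> V)
    : Prop :=
  forall e, e \in F ->
    ctr e \in e /\
    forall f v, f \in F -> v \in e -> v != ctr e -> ctr e \in f -> v \in f ->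
      f = e.

(** If two pairs of e met other triples, these triples and e would form a Berge
    triangle; so the vertex of e opposite to a shared pair, or any vertex if
    there is no shared pair, is a centre. *)
Lemma centred_exists (V : finType) (F : {set {set V}}) (v0 : V) :
  {in F, forall e : {set V}, #|e| = 3} -> berge_free F ->
  exists ctr, centred F ctr.
Proof.
move=> card3 BF.
suff /fin_all_exists[ctr ctrF] : forall e : {set V}, exists c, e \in F ->
    c \in e /\ forall f v, f \in F -> v \in e -> v != c -> c \in f -> v \in f ->
      f = e by exists ctr.
move=> e.
have [Fe|] := boolP (e \in F); last by exists v0.
have /card_gt0P[u ue] : 0 < #|e| by rewrite card3.
have [/existsP[f /and3P[Ff fe /existsP[v /and4P[ve vu uf vf]]]]|/existsPn noheavy]
    := boolP [exists f, [&& f \in F, f != e &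
         [exists v, [&& v \in e, v != u, u \in f & v \in f]]]]; last first.
  exists u => _; split=> // f v Ff ve vu uf vf; apply/eqP.
  have := noheavy f; rewrite Ff /=; apply: contraR => -> /=.
  by apply/existsP; exists v; apply/and4P.
have uv : u != v by rewrite eq_sym.
have [w [eE wu wv]] := card3_third (card3 e Fe) uv ue ve.
have we : w \in e by rewrite eE !inE eqxx orbT.
have wf : w \notin f.
  apply: contra fe => wf; rewrite eq_sym eqEcard !card3 // leqnn andbT eE.
  by apply/subsetP => z; rewrite !inE -orbA => /or3P[]/eqP ->.
exists w => _; split=> // g z Fg ze zw wg zg; apply/eqP/contraT => ge.
have fg : f != g by apply: contraNneq wf => ->.
have : z \in [set u; v; w] by rewrite -eE.
rewrite !inE (negbTE zw) orbF => /orP[]/eqP E; subst z.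
  by case: (BF f e g v u w) => //; rewrite 1?eq_sym //.
by case: (BF f e g u v w) => //; rewrite 1?eq_sym //.
Qed.

Definition arc (V : finType) (F : {set {set V}}) (ctr : {set V} -> V) : rel V :=
  fun x y => [exists e in F, (ctr e == x) && (y \in e :\ x)].

Definition edge (V : finType) (F : {set {set V}}) (ctr : {set V} -> V) : rel V :=
  fun x y => arc F ctr x y || arc F ctr y x.

Section Centred.

Variables (V : finType) (F : {set {set V}}) (ctr : {set V} -> V).
Hypothesis card3 : {in F, forall e : {set V}, #|e| = 3}.
Hypothesis BF : berge_free F.
Hypothesis ctrF : centred F ctr.

Local Notation arc := (arc F ctr).
Local Notation edge := (edge F ctr).

Lemma edgeC : symmetric edge.
Proof. by move=> x y; rewrite /edge orbC. Qed.

Lemma arcP x y :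
  reflect (exists e, [/\ e \in F, ctr e = x, x \in e /\ y \in e, y != x
             & forall f, f \in F -> x \in f -> y \in f -> f = e])
          (arc x y).
Proof.
apply: (iffP existsP) => [[e /and3P[Fe /eqP <-]]|[e [Fe <- [_ ye] yx _]]].
  rewrite !inE => /andP[yx ye]; have [ce own] := ctrF Fe.
  by exists e; split=> // f Ff xf yf; apply: own yx _ _.
by exists e; rewrite Fe eqxx !inE yx.
Qed.

Lemma edge_arc x y : arc x y -> edge x y.
Proof. by rewrite /edge => ->. Qed.

Lemma arc_edge x y : arc y x -> edge x y.
Proof. by rewrite /edge => ->; rewrite orbT. Qed.

Lemma edgeP x y : edge x y ->
  exists e, [/\ e \in F, x \in e /\ y \in e, x != y, (ctr e = x) \/ (ctr e = y)
             & forall f, f \in F -> x \in f -> y \in f -> f = e].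
Proof.
case/orP => /arcP[e [Fe ce [xe ye] yx own]]; exists e; split=> //; auto.
by rewrite eq_sym.
Qed.

Lemma arc_asym x y : arc x y -> ~~ arc y x.
Proof.
case/arcP => e [Fe ce [xe ye] yx own]; apply/negP.
case/arcP => f [Ff cf [yf xf] xy _].
by move: xy; rewrite -cf (own f) // ce eqxx.
Qed.

(** As the pairs are private, two edges of a triangle from the same triple put
    the third edge in that triple too, while only two of its three pairs contain
    the centre. *)
Lemma triangle_free_edge : triangle_free edge.
Proof.
move=> a b c /edgeP[e1 [F1 [a1 b1] ab c1 own1]].
move=> /edgeP[e2 [F2 [a2 c2] ac c2' own2]].
move=> /edgeP[e3 [F3 [b3 c3] bc c3' own3]].
have allE : [|| e1 == e2, e1 == e3 | e2 == e3] -> e1 = e2 /\ e1 = e3.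
  case/or3P => /eqP E.
  - by rewrite -E in c2; split=> //; apply: own3.
  - by rewrite -E in c3; split=> //; apply: own2.
  by rewrite -E in b3; have := own1 _ F2 a2 b3; rewrite -E => ->.
case: (boolP [|| e1 == e2, e1 == e3 | e2 == e3]) => [/allE[E E']|].
  move/eqP: ab; move/eqP: ac; move/eqP: bc.
  by case: c1; case: c2'; case: c3'; congruence.
rewrite !negb_or => /and3P[e12 e13 e23].
by apply: (BF F1 F2 F3 e12 e13 e23 ab ac bc).
Qed.

(** In this form the equation also yields the parity of the outdegree. *)
Lemma outdegree x :
  #|[set y | arc x y]| = 2 * #|[set e in F | ctr e == x]|.
Proof.
have -> : #|[set y | arc x y]|
    = \sum_y \sum_(e in F | ctr e == x) (y \in e :\ x : nat).
  rewrite -sum1dep_card big_mkcond; apply: eq_bigr => y _.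
  case: arcP => [[e [Fe ce [xe ye] yx own]]|H]; last first.
    rewrite big1 // => e /andP[Fe /eqP ce]; apply/eqP; rewrite eqb0.
    apply/negP => ye; apply: H; apply/arcP/existsP; exists e.
    by rewrite Fe ce eqxx.
  rewrite (bigD1 e) /= ?Fe ?ce ?eqxx // !inE yx ye big1 // => f.
  case/andP => /andP[Ff /eqP cf] /eqP fe; apply/eqP; rewrite eqb0 !inE yx /=.
  by apply/negP => yf; apply: fe; apply: own => //; rewrite -cf; case: (ctrF Ff).
rewrite exchange_big /= (eq_bigr (fun=> 2)) => [|e /andP[Fe /eqP ce]].
  rewrite sum_nat_const mulnC; congr (_ * _).
  by apply: eq_card => e; rewrite !inE.
have [+ _] := ctrF Fe; rewrite ce => xe; have := card3 Fe.
rewrite (cardsD1 x) xe -big_mkcond sum1_card => /eqP.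
by rewrite add1n eqSS => /eqP.
Qed.

Lemma sum_degree : \sum_x #|nbr edge x| = 4 * #|F|.
Proof.
have -> : \sum_x #|nbr edge x| = \sum_x \sum_y ((arc x y : nat) + arc y x).
  apply: eq_bigr => x _; rewrite -sum1_card big_mkcond; apply: eq_bigr => y _.
  rewrite inE /edge; case xy: (arc x y) => /=; last by case: (arc y x).
  by rewrite (negbTE (arc_asym xy)).
under eq_bigr => x _ do rewrite big_split.
rewrite big_split /= [X in _ + X]exchange_big /= addnn -mul2n.
have -> : \sum_x \sum_y (arc x y : nat) = 2 * #|F|; last by rewrite mulnA.
transitivity (\sum_x 2 * #|[set e in F | ctr e == x]|).
  apply: eq_bigr => x _; rewrite -outdegree -sum1dep_card [RHS]big_mkcond /=.
  by apply: eq_bigr => y _; case: arc.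
rewrite -big_distrr /= -sum1_card (partition_big ctr predT) //=; congr (_ * _).
by apply: eq_bigr => x _; rewrite sum1dep_card.
Qed.

End Centred.

(** * Systems with the maximum number of triples *)

Section Extremal.

Variables (V : finType) (F : {set {set V}}) (ctr : {set V} -> V).
Hypothesis card3 : {in F, forall e : {set V}, #|e| = 3}.
Hypothesis BF : berge_free F.
Hypothesis ctrF : centred F ctr.

Local Notation arc := (arc F ctr).
Local Notation edge := (edge F ctr).

(** The second clause bounds the number of missing edges by one; unlike a bound on
    [missing], this form is visibly invariant under exchanging the two sides
    ([nearly_completeC]). *)
Definition nearly_complete (X : {set V}) : Prop :=
  (forall x y, edge x y -> (x \in X) != (y \in X)) /\
  (forall x y x' y', x \in X -> y \notin X -> x' \in X -> y' \notin X ->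
     ~~ edge x y -> ~~ edge x' y' -> x = x' /\ y = y').

Lemma nearly_completeC X : nearly_complete X -> nearly_complete (~: X).
Proof.
case=> cross few; split=> [x y|x y x' y'].
  by move=> /cross; rewrite !inE; case: (x \in X); case: (y \in X).
rewrite !inE !negbK => Xx Xy Xx' Xy' nxy nxy'.
by have [] := few y x y' x' Xy Xx Xy' Xx'; rewrite // edgeC.
Qed.

Lemma arc_sides X x y : nearly_complete X -> arc x y -> (y \in X) = (x \notin X).
Proof. by case=> cross _ /edge_arc/cross; case: (x \in X); case: (y \in X). Qed.

Lemma mem_arc e z : e \in F -> z \in e -> z != ctr e -> arc (ctr e) z.
Proof. by move=> Fe ze zc; apply/existsP; exists e; rewrite Fe eqxx !inE zc. Qed.

Lemma card_leaf_pair z e : e \in F -> z \in e -> #|e :\ z| = 2.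
Proof.
by move=> Fe ze; have := card3 Fe; rewrite (cardsD1 z) ze add1n => -[].
Qed.

(** Let vab have centre v and yvu have centre y.  Then u is on the side of v,
    and adjacent to neither a nor b: a triple containing ua would close a Berge
    triangle on u, v, a.  These are two missing edges. *)
Lemma not_centre_and_leaf X v a y :
  nearly_complete X -> arc v a -> arc y v -> False.
Proof.
wlog Xv : X / v \in X => [wl|] nc va yv.
  have [Xv|Xv] := boolP (v \in X); first exact: (wl X).
  by apply: (wl (~: X)) => //; [rewrite inE|apply: nearly_completeC].
have [e [Fe ce [ve ae] av own_e]] := arcP ctrF _ _ va.
have [f [Ff cf [yf vf] vy own_f]] := arcP ctrF _ _ yv.
have Xy : y \notin X by rewrite -(arc_sides nc yv).
have va' : v != a by rewrite eq_sym.
have [b [eE bv ba]] := card3_third (card3 Fe) va' ve ae.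
have yv' : y != v by rewrite eq_sym.
have [u [fE uy uv]] := card3_third (card3 Ff) yv' yf vf.
have uf : u \in f by rewrite fE !inE eqxx orbT.
have be : b \in e by rewrite eE !inE eqxx orbT.
have Xu : u \in X.
  by rewrite (arc_sides (x := y) nc) // -cf; apply: mem_arc; rewrite ?cf.
have nu a' : a' \in e -> a' != v -> ~~ edge u a'.
  move=> a'e a'v; apply/negP => /(edgeP ctrF)[g [Fg [ug a'g] ua' _ _]].
  have arc_va' : arc v a' by rewrite -ce; apply: mem_arc; rewrite ?ce.
  have ef : e != f by apply: contraNneq vy => ef; rewrite -ce ef cf.
  have eg : e != g.
    apply: contraTneq Xu => eg; rewrite (arc_sides (x := v) nc) ?Xv // -ce.
    by apply: mem_arc; rewrite ?ce // eg.
  have fg : f != g.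
    apply/eqP => fg; have [a'y|a'y] := eqVneq a' y.
      by have := arc_asym ctrF arc_va'; rewrite a'y yv.
    have : arc y a' by rewrite -cf; apply: mem_arc; rewrite ?cf ?fg.
    by move/(arc_sides nc); rewrite (arc_sides nc arc_va') Xv Xy.
  by apply: (BF Fe Ff Fg ef eg fg _ _ _ ve a'e vf uf a'g ug); rewrite eq_sym.
have nX a' : a' \in e -> a' != v -> a' \notin X.
  move=> a'e a'v; rewrite (arc_sides (x := v) nc) ?Xv // -ce.
  by apply: mem_arc; rewrite ?ce.
have [] := nc.2 u a u b Xu (nX a ae av) Xu (nX b be bv) (nu a ae av) (nu b be bv).
by move=> _ ab; rewrite ab eqxx in ba.
Qed.

(** Suppose that x is on the other side.  No vertex being both a centre and
    a leaf, the two centres x0 and x are not adjacent, and neither are the two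
    leaves y and y0: again two missing edges. *)
Lemma centres_on_one_side X x0 y0 x y :
  nearly_complete X -> arc x0 y0 -> x0 \in X -> arc x y -> x \in X.
Proof.
move=> nc xy0 Xx0 xy; apply/negPn/negP => Xx.
have Xy : y \in X by rewrite (arc_sides nc xy).
have Xy0 : y0 \notin X by rewrite (arc_sides nc xy0) Xx0.
have n1 : ~~ edge x0 x.
  apply/negP => /orP[x0x|xx0]; first exact: not_centre_and_leaf nc xy x0x.
  exact: not_centre_and_leaf nc xy0 xx0.
have n2 : ~~ edge y y0.
  apply/negP => /orP[yy0|y0y]; first exact: not_centre_and_leaf nc yy0 xy.
  exact: not_centre_and_leaf nc y0y xy0.
have [x0y _] := nc.2 _ _ _ _ Xx0 Xx Xy Xy0 n1 n2.
by subst y; apply: not_centre_and_leaf nc xy0 xy.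
Qed.

(** If xy were missing, the outdegree of x would be one less than that of any
    other vertex x' of X, although both are even. *)
Lemma complete_from_parity X x y :
  nearly_complete X -> (forall u v, arc u v -> u \in X) ->
  (forall u v, u \in X -> v \notin X -> ~~ edge u v -> 1 < #|X|) ->
  x \in X -> y \notin X -> arc x y.
Proof.
move=> nc fromX bigX Xx Xy; have edge_out u v : u \in X -> edge u v -> arc u v.
  move=> Xu /orP[//|vu].
  by have := arc_sides nc vu; rewrite Xu (fromX _ _ vu).
have [xy|nxy] := boolP (edge x y); first exact: edge_out.
have [x' Xx' x'x] : exists2 x', x' \in X & x' != x.
  have : 0 < #|X :\ x| by have := bigX x y Xx Xy nxy; rewrite (cardsD1 x) Xx.
  by case/card_gt0P => x'; rewrite !inE => /andP[? ?]; exists x'.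
have out_x : [set v | arc x v] = ~: X :\ y.
  apply/setP => v; rewrite !inE; apply/idP/andP => [xv|[vy Xv]].
    by rewrite (arc_sides nc xv) Xx; split=> //; apply: contraNneq nxy => <-;
      apply: edge_arc.
  apply: edge_out => //; apply: contraR vy => nxv.
  by have [_ ->] := nc.2 _ _ _ _ Xx Xv Xx Xy nxv nxy.
have out_x' : [set v | arc x' v] = ~: X.
  apply/setP => v; rewrite !inE; apply/idP/idP => [xv|Xv].
    by rewrite (arc_sides nc xv) Xx'.
  apply: edge_out => //; apply: contraR x'x => nxv.
  by have [->] := nc.2 _ _ _ _ Xx' Xv Xx Xy nxv nxy.
have := outdegree card3 ctrF x; have := outdegree card3 ctrF x'.
by rewrite out_x out_x' (cardsD1 y (~: X)) inE Xy; lia.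
Qed.

(** If y were paired with b by the centre x but with another vertex by the
    centre x', then the triples containing yb, yx' and bx' would form a Berge
    triangle. *)
Lemma leaf_pair_determined X e e' y :
  nearly_complete X -> (forall u v, arc u v -> u \in X) ->
  (forall u v, u \in X -> v \notin X -> arc u v) ->
  e \in F -> e' \in F -> y \notin X -> y \in e -> y \in e' ->
  e :\ ctr e = e' :\ ctr e'.
Proof.
move=> nc fromX complete Fe Fe' Xy ye ye'.
have ctrX f : f \in F -> y \in f -> ctr f \in X.
  move=> Ff yf.
  have [yc|yc] := eqVneq y (ctr f); last exact: fromX _ _ (mem_arc Ff yf yc).
  have : 0 < #|f :\ y| by rewrite card_leaf_pair.
  case/card_gt0P => z; rewrite !inE => /andP[zy zf].
  by apply: (fromX _ z); apply: mem_arc => //; rewrite -yc.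
have Xc := ctrX _ Fe ye; have Xc' := ctrX _ Fe' ye'.
have yc : y != ctr e by apply: contraNneq Xy => ->.
have yc' : y != ctr e' by apply: contraNneq Xy => ->.
have [ce own] := ctrF Fe; have [ce' own'] := ctrF Fe'.
have [E|cc'] := eqVneq (ctr e) (ctr e').
  by have -> : e' = e by apply: own yc _ ye'; rewrite // E.
have card2 f : f \in F -> #|f :\ ctr f| = 2.
  by move=> Ff; apply: card_leaf_pair => //; have [] := ctrF Ff.
apply/eqP; rewrite eqEcard !card2 // leqnn andbT; apply/subsetP => b.
rewrite !inE => /andP[bc be]; have Xb : b \notin X.
  by rewrite (arc_sides nc (mem_arc Fe be bc)) Xc.
have bc' : b != ctr e' by apply: contraNneq Xb => ->.
rewrite bc' /=; apply/negPn/negP => be'.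
have [g [Fg _ [c'g bg] _ _]] := arcP ctrF _ _ (complete _ _ Xc' Xb).
have c'e : ctr e' \notin e.
  apply/negP => c'e; have := arc_sides (x := ctr e) (y := ctr e') nc.
  by rewrite Xc Xc' mem_arc 1?eq_sym // => /(_ isT).
apply: (BF (e1 := e) (e2 := e') (e3 := g) (a := y) (b := b) (c := ctr e')) => //.
- by apply: contraNneq be' => <-.
- by apply: contraNneq c'e => ->.
- by apply: contraNneq be' => ->.
- by apply: contraNneq be' => <-.
Qed.

Lemma complete_is_Fnk X :
  F != set0 ->
  nearly_complete X -> (forall u v, arc u v -> u \in X) ->
  (forall u v, u \in X -> v \notin X -> arc u v) ->
  exists k, is_Fnk k F.
Proof.
case/set0Pn => e0 Fe0 nc fromX complete.
pose P := [set e :\ ctr e | e in F].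
have PE e : e \in F -> e :\ ctr e \in P by move=> Fe; apply/imsetP; exists e.
have leaf e z : e \in F -> z \in e :\ ctr e -> z \notin X.
  move=> Fe; rewrite !inE => /andP[zc ze]; have := mem_arc Fe ze zc => cz.
  by rewrite (arc_sides nc cz) negbK (fromX _ _ cz).
have card2 f : f \in F -> #|f :\ ctr f| = 2.
  by move=> Ff; apply: card_leaf_pair => //; have [] := ctrF Ff.
have leafX e : e \in F -> exists2 z, z \in e :\ ctr e & z \in e.
  move=> Fe; have /card_gt0P[z] : 0 < #|e :\ ctr e| by rewrite card2.
  by move=> zc; exists z => //; move: zc; rewrite !inE => /andP[].
have ctrX e : e \in F -> ctr e \in X.
  move=> Fe; have [z] := leafX e Fe; rewrite !inE => /andP[zc _ ze].
  exact: fromX _ _ (mem_arc Fe ze zc).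
have det := leaf_pair_determined nc fromX complete.
exists #|P|, (fun i => enum_val i), X; split.
- by move=> i; have /imsetP[e Fe ->] := enum_valP i; apply: card2.
- move=> i j; apply: contraNT => /pred0Pn[y /andP[/= yi yj]].
  apply/eqP/enum_val_inj; move: yi yj.
  have /imsetP[e Fe ->] := enum_valP i; have /imsetP[e' Fe' ->] := enum_valP j.
  move=> ye; have Xy := leaf _ _ Fe ye; move: ye.
  by rewrite !inE => /andP[_ ye] /andP[_ ye']; apply: det Xy ye ye'.
- move=> i; have /imsetP[e Fe ->] := enum_valP i.
  by apply/pred0P => y /=; apply/negP => /andP[/leaf-/(_ Fe)/negP].
- apply/setP => y; rewrite !inE orbC; have [//|Xy] /= := boolP (y \in X).
  have [e [Fe ce [_ ye] yc _]] := arcP ctrF _ _ (complete _ _ (ctrX _ Fe0) Xy).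
  apply/bigcupP; exists (enum_rank_in (PE _ Fe) (e :\ ctr e)) => //.
  by rewrite enum_rankK_in ?PE // ce !inE yc.
apply/setP => t; apply/idP/imset2P => [Ft|[i b _ Xb ->]].
  exists (enum_rank_in (PE _ Ft) (t :\ ctr t)) (ctr t); rewrite ?ctrX //.
  by rewrite enum_rankK_in ?PE // setUC setD1K // (ctrF Ft).1.
have /imsetP[e Fe ->] := enum_valP i; have [y yc ye] := leafX e Fe.
have Xy := leaf _ _ Fe yc.
have [e' [Fe' ce' [be' ye'] _ _]] := arcP ctrF _ _ (complete _ _ Xb Xy).
by rewrite (det _ _ _ Fe Fe' Xy ye ye') ce' setUC setD1K.
Qed.

(** The side containing one centre, be it X or its complement, contains them
    all. *)
Lemma extremal_is_Fnk :
  3 <= #|V| -> #|V| ^ 2 %/ 8 <= #|F| -> exists k, is_Fnk k F.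
Proof.
move=> n3 leF; have F0 : F != set0.
  rewrite -card_gt0; apply: leq_trans leF.
  by rewrite divn_gt0 //; apply: (@leq_trans (3 ^ 2)); rewrite // leq_exp2r.
have [X [cross M1 M2]] := near_extremal n3 (@edgeC _ F ctr)
  (triangle_free_edge BF ctrF) (sum_degree card3 ctrF) leF.
have nc : nearly_complete X.
  by split=> // x y x' y'; apply: missing_le1.
have big u v : u \in X -> v \notin X -> ~~ edge u v -> 1 < #|X| /\ 1 < #|~: X|.
  move=> Xu Xv uv; apply: M2; apply/eqP; rewrite eqn_leq M1 lt0n.
  apply/eqP => /eqP; rewrite /missing sum_nat_eq0 => /forallP/(_ u).
  by rewrite Xu cards_eq0 => /eqP/setP/(_ v); rewrite !inE uv Xv.
have finish Y : nearly_complete Y ->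
    (forall u v, u \in Y -> v \notin Y -> ~~ edge u v -> 1 < #|Y|) ->
    (exists x y, x \in Y /\ arc x y) -> exists k, is_Fnk k F.
  move=> ncY bigY [x0 [y0 [Yx0 xy0]]].
  have fromY u v : arc u v -> u \in Y := centres_on_one_side ncY xy0 Yx0.
  by apply: (complete_is_Fnk F0 ncY fromY) => u v; apply: complete_from_parity.
have [e Fe] := set0Pn _ F0.
have [z ze zc] : exists2 z, z \in e & z != ctr e.
  have : 0 < #|e :\ ctr e|.
    by rewrite card_leaf_pair //; have [] := ctrF Fe.
  by case/card_gt0P => z; rewrite !inE => /andP[? ?]; exists z.
have cz := mem_arc Fe ze zc.
have [Xc|Xc] := boolP (ctr e \in X).
  apply: (finish X) => // [u v Xu Xv /(big u v Xu Xv)[]//|].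
  by exists (ctr e), z.
apply: (finish (~: X)).
- exact: nearly_completeC.
- move=> u v; rewrite !inE negbK => Xu Xv uv.
  by have [] := big v u Xv Xu; rewrite // edgeC.
by exists (ctr e), z; rewrite inE.
Qed.

End Extremal.

(** * The upper bound *)

(** Mantel's bound for the 2|F| private pairs, followed by 4xy <= (x + y)^2. *)
Lemma berge_free_card (V : finType) (F : {set {set V}}) :
  {in F, forall e : {set V}, #|e| = 3} -> berge_free F ->
  #|F| <= #|V| ^ 2 %/ 8.
Proof.
move=> card3 BF.
have [->|/set0Pn[e Fe]] := eqVneq F set0; first by rewrite cards0.
have /card_gt0P[v _] : 0 < #|e| by rewrite card3.
have [ctr ctrF] := centred_exists v card3 BF.
have [X [_ leI E]] :=
  mantel_deficit v (@edgeC _ F ctr) (triangle_free_edge BF ctrF).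
rewrite (sum_degree card3 ctrF) in E; rewrite leq_divRL // -(cardsC X).
apply: leq_trans (nat_AGM2 _ _); move: E leI; lia.
Qed.

(** * The systems F_{n,k} *)

Lemma Fnk_card (V : finType) k (F : {set {set V}}) :
  is_Fnk k F -> 2 * k <= #|V| /\ #|F| = k * (#|V| - 2 * k).
Proof.
case=> A [B [A2 disjA disjAB coverV ->]].
have cardA : #|\bigcup_(i < k) A i| = 2 * k.
  rewrite -sum1_card partition_disjoint_bigcup //.
  under eq_bigr => i _ do rewrite sum1_card A2.
  by rewrite sum_nat_const card_ord mulnC.
have cardV : #|V| = 2 * k + #|B|.
  rewrite -cardA -cardsT -coverV cardsU.
  suff -> : (\bigcup_(i < k) A i) :&: B = set0 by rewrite cards0 subn0.
  apply/setP => x; rewrite !inE; apply/negP => /andP[/bigcupP[i _ xA] xB].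
  by have /pred0P/(_ x) := disjAB i; rewrite /= xA xB.
have notA i b : b \in B -> b \notin A i.
  move=> Bb; apply/negP => bA.
  by have /pred0P/(_ b) := disjAB i; rewrite /= bA Bb.
split; first by rewrite cardV leq_addr.
have -> : [set A i :|: [set b] | i in 'I_k, b in B]
    = [set A p.1 :|: [set p.2] | p in setX [set: 'I_k] B].
  apply/setP => t; apply/imset2P/imsetP => [[i b _ Bb ->]|[[i b]]].
    by exists (i, b); rewrite ?inE.
  by rewrite !inE /= => Bb ->; exists i b.
rewrite cardV addKn card_in_imset ?cardsX ?cardsT ?card_ord //.
move=> [i b] [j b']; rewrite !inE /= => Bb Bb' E.
have bb' : b = b'.
  have : b \in A j :|: [set b'] by rewrite -E !inE eqxx orbT.
  by rewrite !inE (negbTE (notA _ _ Bb)) => /eqP.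
subst b'; have [->//|/disjA] := eqVneq i j.
have /card_gt0P[x xi] : 0 < #|A i| by rewrite A2.
move=> /pred0P/(_ x); rewrite /= xi /=.
have : x \in A j :|: [set b] by rewrite -E !inE xi.
rewrite !inE => /orP[->//|/eqP xb].
by move: (notA i b Bb); rewrite -xb xi.
Qed.

Lemma Fnk_triple_system (V : finType) k (F : {set {set V}}) :
  is_Fnk k F -> triple_system F.
Proof.
case=> A [B [A2 disjA disjAB coverV ->]].
apply/forallP => e; apply/implyP => /imset2P[i b _ Bb ->].
rewrite setUC cardsU1 A2; case: (boolP (b \in A i)) => // bA.
by have /pred0P/(_ b) := disjAB i; rewrite /= bA Bb.
Qed.

(** A Berge triangle on a, b, c with a in B has both triples at a of the form
    A_i + a; so b and c lie in distinct pairs, and no triple covers bc.  Without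
    vertex in B, all of a, b, c would belong to one pair A_i. *)
Lemma Fnk_berge_free (V : finType) k (F : {set {set V}}) :
  is_Fnk k F -> berge_free F.
Proof.
case=> A [B [A2 disjA disjAB coverV ->]].
have notA i b : b \in B -> b \notin A i.
  move=> Bb; apply/negP => bA.
  by have /pred0P/(_ b) := disjAB i; rewrite /= bA Bb.
have inj i j x : x \in A i -> x \in A j -> i = j.
  move=> xi xj; apply/eqP/contraT => /disjA/pred0P/(_ x).
  by rewrite /= xi xj.
have same i j u v w p q : p \in B -> q \in B -> u \in B -> v != u -> w != u ->
    u \in A i :|: [set p] -> v \in A i :|: [set p] ->
    u \in A j :|: [set q] -> w \in A j :|: [set q] ->
    [/\ p = q, v \in A i & w \in A j].
  move=> Bp Bq Bu vu wu; rewrite !inE !(negbTE (notA _ _ Bu)) /=.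
  move=> /eqP up + /eqP uq; subst p q.
  by rewrite (negbTE vu) (negbTE wu) !orbF => -> ->.
have pair i p u : u \notin B -> p \in B -> u \in A i :|: [set p] -> u \in A i.
  by move=> Bu Bp; rewrite !inE => /orP[//|/eqP up]; rewrite up Bp in Bu.
(* The case of a triangle vertex u in B, stated so that a, b and c can all play
   its part. *)
have noB i j l p q r u v w :
    p \in B -> q \in B -> r \in B -> v != u -> w != u ->
    A i :|: [set p] != A j :|: [set q] -> u \in B ->
    u \in A i :|: [set p] -> v \in A i :|: [set p] ->
    u \in A j :|: [set q] -> w \in A j :|: [set q] ->
    v \in A l :|: [set r] -> w \in A l :|: [set r] -> False.
  move=> Bp Bq Br vu wu ne Bu u1 v1 u2 w2 v3 w3.
  have [pq vi wj] := same i j u v w p q Bp Bq Bu vu wu u1 v1 u2 w2.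
  have vB : v \notin B by apply: contraL vi; apply: notA.
  have wB : w \notin B by apply: contraL wj; apply: notA.
  have il := inj _ _ _ vi (pair _ _ _ vB Br v3).
  have jl := inj _ _ _ wj (pair _ _ _ wB Br w3).
  by move: ne; rewrite il jl pq eqxx.
move=> e1 e2 e3 a b c /imset2P[i p _ Bp ->] /imset2P[j q _ Bq ->].
move=> /imset2P[l r _ Br ->] e12 e13 e23 ab ac bc a1 b1 a2 c2 b3 c3.
have [ba ca cb] : [/\ b != a, c != a & c != b].
  by rewrite !(eq_sym _ a) (eq_sym c).
have [Ba|Ba] := boolP (a \in B).
  exact: (noB i j l p q r a b c).
have [Bb|Bb] := boolP (b \in B).
  exact: (noB i l j p r q b a c).
have [Bc|Bc] := boolP (c \in B).
  exact: (noB j l i q r p c a b).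
have ij := inj _ _ _ (pair _ _ _ Ba Bp a1) (pair _ _ _ Ba Bq a2); subst j.
have : [set a; b; c] \subset A i.
  apply/subsetP => x; rewrite !inE -orbA => /or3P[]/eqP ->.
  - exact: pair Ba Bp a1.
  - exact: pair Bb Bp b1.
  - exact: pair Bc Bq c2.
move/subset_leq_card; rewrite A2 -setUA cardsU1 cards2 !inE negb_or ab ac bc.
by [].
Qed.

Lemma Fnk_size_le n k : k * (n - 2 * k) <= n ^ 2 %/ 8.
Proof.
have [le_kn|/ltnW lt_nk] := leqP (2 * k) n; last first.
  by rewrite (eqP lt_nk) muln0.
rewrite leq_divRL // -[X in _ <= X ^ 2](subnKC le_kn).
by apply: leq_trans (nat_AGM2 _ _); lia.
Qed.

(** (n + 1)/4, rounded down, is an integer closest to n/4. *)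
Lemma Fnk_size_eq n (k := n.+1 %/ 4) : 3 <= n ->
  [/\ 0 < k, 2 * k < n & k * (n - 2 * k) = n ^ 2 %/ 8].
Proof.
move=> n3; have [k0 kn] : 0 < k /\ 2 * k < n by rewrite /k; lia.
split=> //; apply/eqP; rewrite eqn_leq Fnk_size_le -ltnS ltn_divLR //.
have [d [nE d2]] : exists d, n = 4 * k + d - 1 /\ d < 4.
  by exists (n.+1 %% 4); rewrite /k; split; lia.
rewrite -mulnn; move: (k) k0 kn nE => {}k k0 kn ->; rewrite -subnDA.
case: d d2 => [|[|[|[|//]]]] _; nia.
Qed.

Lemma optimal_size n k : 3 <= n -> optimal n k -> k * (n - 2 * k) = n ^ 2 %/ 8.
Proof.
move=> n3 [k0 kn max]; have [j0 jn <-] := Fnk_size_eq n3.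
apply/eqP; rewrite eqn_leq max // andbT.
by have [_ _ ->] := Fnk_size_eq n3; apply: Fnk_size_le.
Qed.

(** The pairs are {0, 1}, {2, 3}, ..., {2k - 2, 2k - 1}. *)
Lemma Fnk_exists n k : 2 * k <= n -> exists F : {set {set 'I_n}}, is_Fnk k F.
Proof.
move=> le_kn; pose A (i : 'I_k) := [set v : 'I_n | v./2 == i].
pose B := [set v : 'I_n | 2 * k <= v].
exists [set A i :|: [set b] | i in 'I_k, b in B], A, B; split=> //.
- move=> i; have i1 : i.*2.+1 < n by have := ltn_ord i; lia.
  have -> : A i = [set Ordinal (ltnW i1); Ordinal i1].
    by apply/setP => v; rewrite !inE -!val_eqE /=; lia.
  by rewrite cards2 -val_eqE /= neq_ltn ltnSn.
- move=> i j ij; apply/pred0P => v; rewrite /= !inE.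
  apply/negP => /andP[/eqP vi /eqP vj].
  by move: ij; rewrite -val_eqE /= -vi vj eqxx.
- move=> i; apply/pred0P => v; rewrite /= !inE; have := ltn_ord i; lia.
apply/setP => v; rewrite !inE orbC; case: leqP => //= vk.
have hv : v./2 < k by lia.
by apply/bigcupP; exists (Ordinal hv); rewrite // inE.
Qed.

(** * The extremal number and the extremal systems *)

Theorem theorem1 (n : nat) (hn : 0 < n) :
  ex n [:: configA; configB; configC; configD] = n ^ 2 %/ 8 /\
  (3 <= n ->
   forall (V : finType) (F : {set {set V}}),
     #|V| = n ->
     triple_system F ->
     contains_none F [:: configA; configB; configC; configD] ->
     (#|F| = n ^ 2 %/ 8 <-> exists k : nat, optimal n k /\ is_Fnk k F)).
Proof.
have card3 (V : finType) (F : {set {set V}}) :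
    triple_system F -> {in F, forall e : {set V}, #|e| = 3}.
  by move=> /forallP F3 e Fe; apply/eqP; have /implyP := F3 e; apply.
split.
  apply/eqP; rewrite eqn_leq; apply/andP; split.
    apply/bigmax_leqP => F /andP[F3 /(contains_none_berge_free F3) BF].
    by have := berge_free_card (card3 _ _ F3) BF; rewrite card_ord.
  have [n3|n3] := leqP 3 n; last by case: n n3 {hn} => [|[|[|]]].
  have [k0 kn <-] := Fnk_size_eq n3.
  have [F Fk] := Fnk_exists (ltnW kn); have F3 := Fnk_triple_system Fk.
  have [_ ] := Fnk_card Fk; rewrite card_ord => <-.
  apply: (bigmax_sup F) => //; rewrite F3 /=.
  by apply/(contains_none_berge_free F3)/Fnk_berge_free/Fk.
move=> n3 V F cardV F3 /(contains_none_berge_free F3) BF.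
split=> [cardF|[k [optk Fk]]]; last first.
  by rewrite -(optimal_size n3 optk) (Fnk_card Fk).2 cardV.
have /card_gt0P[v _] : 0 < #|V| by rewrite cardV.
have [ctr ctrF] := centred_exists v (card3 _ _ F3) BF.
have [||k Fk] := extremal_is_Fnk (card3 _ _ F3) BF ctrF.
- by rewrite cardV.
- by rewrite cardV cardF.
exists k; split=> //; have [_] := Fnk_card Fk; rewrite cardF cardV => E.
have : 0 < k * (n - 2 * k).
  by rewrite -E; have [j0 jn <-] := Fnk_size_eq n3; rewrite muln_gt0 j0 subn_gt0.
rewrite muln_gt0 subn_gt0 => /andP[k0 kn]; split=> // j _ _.
by rewrite -E; apply: Fnk_size_le.
Qed.
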